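(* Let $V$ be a set of $n$ vertices and $U\subseteq V$ with $2\le |U|\le n-1$. Then the clique number of the 1-skeleton of the polytope $SVMST_{n,U}$ satisfies $$\omega(SVMST_{n,U}) \geq 2^{\left(\sqrt{\left\lfloor \frac{n-|U|-1}{2}\right\rfloor}-9\right)/2}.$$
   Context: $K_n$ is the complete graph on $V$ with edge set $E$, $|E|=d=n(n-1)/2$. For a subgraph $t$ of $K_n$, $x(t)\in\mathbb{R}^d$ (coordinates indexed by $E$) is its characteristic vector: coordinate $1$ for edges of $t$, $0$ otherwise. $SVMST_{n,U}$ is the convex hull of the characteristic vectors of all spanning trees of $K_n$ all of whose leaves (vertices of degree $1$) belong to $U$. The 1-skeleton of a polytope is the graph whose vertices are the polytope's vertices and whose edges are its 1-dimensional faces; $\omega(\cdot)$ denotes its clique number (size of a largest clique). *)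

(* Defs.v *)
From HB Require Import structures.
From mathcomp Require Import all_boot all_order all_algebra.
From mathcomp Require Import all_classical all_reals.
From mathcomp Require Import exp.
Set Implicit Arguments. Unset Strict Implicit. Unset Printing Implicit Defensive.
Import Order.TTheory GRing.Theory Num.Theory.
Local Open Scope ring_scope.

Definition Kedge (n : nat) := {e : {set 'I_n} | #|e| == 2}.

Definition tadj n (T : {set Kedge n}) : rel 'I_n :=
  fun u v => [exists e in T, val e == [set u; v]].

Definition tconnected n (T : {set Kedge n}) : Prop :=
  forall u v : 'I_n, connect (tadj T) u v.

(* acyclic: no edge lies on a cycle, i.e. the endpoints of every edge e of T
   are disconnected in T minus e *)
Definition tacyclic n (T : {set Kedge n}) : Prop :=
  forall e, e \in T -> forall u v, val e = [set u; v] ->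
    ~~ connect (tadj (T :\ e)) u v.

Definition spanning_tree n (T : {set Kedge n}) : Prop :=
  tconnected T /\ tacyclic T.

Definition tdeg n (T : {set Kedge n}) (v : 'I_n) : nat :=
  #|[set e in T | v \in val e]|.

Definition leaves_in n (T : {set Kedge n}) (U : {set 'I_n}) : Prop :=
  forall v, tdeg T v = 1%N -> v \in U.

Definition charvec (R : realType) n (T : {set Kedge n}) : {ffun Kedge n -> R} :=
  [ffun e => if e \in T then 1 else 0].

Definition svmst_pts (R : realType) n (U : {set 'I_n}) (z : {ffun Kedge n -> R}) : Prop :=
  exists T, [/\ spanning_tree T, leaves_in T U & z = charvec R T].

Section Poly.
Variables (R : realType) (E : finType).
Definition dotp (c z : {ffun E -> R}) : R := \sum_e c e * z e.

Definition in_conv (S : {ffun E -> R} -> Prop) (z : {ffun E -> R}) : Prop :=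
  exists (k : nat) (p : 'I_k -> {ffun E -> R}) (w : 'I_k -> R),
    [/\ forall i, S (p i), forall i, 0 <= w i, \sum_i w i = 1 &
        forall e, z e = \sum_i w i * p i e].

Definition face_of (S : {ffun E -> R} -> Prop) (c z : {ffun E -> R}) : Prop :=
  in_conv S z /\ forall y, in_conv S y -> dotp c y <= dotp c z.

Definition is_vertex (S : {ffun E -> R} -> Prop) (p : {ffun E -> R}) : Prop :=
  exists c, face_of S c p /\ forall z, face_of S c z -> z = p.

Definition skel_edge (S : {ffun E -> R} -> Prop) (p q : {ffun E -> R}) : Prop :=
  [/\ is_vertex S p, is_vertex S q, p <> q &
  exists c, [/\ face_of S c p, face_of S c q &
     forall z, face_of S c z ->
       exists t : R, [/\ 0 <= t, t <= 1 & forall e, z e = t * p e + (1 - t) * q e]]].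

Definition skel_clique (S : {ffun E -> R} -> Prop) (m : nat)
  (v : 'I_m -> {ffun E -> R}) : Prop :=
  (forall i, is_vertex S (v i)) /\ (forall i j, i != j -> skel_edge S (v i) (v j)).
End Poly.

(* Main.v *)
Require Import Defs.
From HB Require Import structures.
From mathcomp Require Import all_boot all_order all_algebra.
From mathcomp Require Import all_classical all_reals.
From mathcomp Require Import exp.
From mathcomp Require Import fintype finset.
From mathcomp Require Import zify lra.
Import Order.TTheory GRing.Theory Num.Theory.
Set Implicit Arguments. Unset Strict Implicit. Unset Printing Implicit Defensive.

(* Idea. Fix two vertices u1, u2 of U. A spanning tree between two Hamiltonian
   paths from u1 to u2 (containing their common edges, contained in their union)
   whose leaves lie in U has degree 2 off u1 and u2, by counting edges. So it
   suffices to find 2^r Hamiltonian u1-u2 paths such that between any two of them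
   there is no third tree with leaves in U; two such paths span an edge of the
   polytope.

   The paths encode bit vectors x. They are directed paths through O(r^2) nodes,
   each node being doubled into an entry and an exit vertex joined by an edge common
   to all the paths. Bit i decides in which direction row i is traversed, and for
   i < j the node ND i j is visited by row i if x i = 0 and by row j if x i = 1.
   In a tree T between the paths of x and y, each exit vertex chooses between its
   x-successor and its y-successor. Two exits competing for the same entry choose
   the same bit vector, and a 2-cycle of nodes would be a 4-cycle of T; this makes the
   choice constant along each row that x and y traverse in opposite directions. The
   nodes ND i j couple any two such rows, so that T is the path of x or of y. *)

(** * Traversals of the gadget *)

(* Row i is the sequence NB i 0, NP i 0 false, NP i 0 true, NB i 1, NP i 1 false, ..., NB i r,
   read backwards when x i holds; a detour through ND i j or ND j i is inserted between
   NP i j false and NP i j true.  NS i precedes row i, and NS r ends the traversal.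
   Only the nodes ND i j with i < j occur. *)
Inductive node := NS of nat | NB of nat & nat | NP of nat & nat & bool | ND of nat & nat.

Definition node_code (v : node) : nat + nat * nat + nat * nat * bool + nat * nat :=
  match v with
  | NS i => inl (inl (inl i)) | NB i j => inl (inl (inr (i, j)))
  | NP i j h => inl (inr (i, j, h)) | ND i j => inr (i, j)
  end.

Definition node_decode (c : nat + nat * nat + nat * nat * bool + nat * nat) : node :=
  match c with
  | inl (inl (inl i)) => NS i | inl (inl (inr (i, j))) => NB i j
  | inl (inr (i, j, h)) => NP i j h | inr (i, j) => ND i j
  end.

Lemma node_codeK : cancel node_code node_decode.
Proof. by case. Qed.
HB.instance Definition _ := Equality.copy node (can_type node_codeK).

(** The bit of the smaller index decides which of two rows visits their shared node, so for distinct
    [i] and [j] exactly one of [detour x i j] and [detour x j i] holds. *)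
Definition detour (x : nat -> bool) (i j : nat) : bool :=
  if i < j then ~~ x i else (j < i) && x j.

Definition succ (r : nat) (x : nat -> bool) (v : node) : node :=
  match v with
  | NS i => NB i (if x i then r else 0)
  | NB i j =>
      if x i then (if j is j'.+1 then NP i j' true else NS i.+1)
      else (if j == r then NS i.+1 else NP i j false)
  | NP i j h =>
      if h == x i then
        (if detour x i j then ND (minn i j) (maxn i j) else NP i j (~~ h))
      else NB i (j + h)
  | ND i j => if x i then NP j i (~~ x j) else NP i j true
  end.

(* The nodes of the traversal other than its end NS r. *)
Definition inner (r : nat) (v : node) : bool :=
  match v with
  | NS i => i < r
  | NB i j => (i < r) && (j <= r)
  | NP i j h => (i < r) && (j < r)
  | ND i j => i < j < r
  end.

Lemma leq_add_bool j r (b : bool) : j < r -> j + b <= r.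
Proof. by case: b => /=; lia. Qed.

(* F v says that a tree between the paths of x and y leaves v towards its x-successor rather than
   its y-successor. *)
Section Choice.
Variables (r : nat) (x y : nat -> bool) (F : node -> bool).
Hypothesis F_in : forall v u, inner r v -> inner r u -> v != u ->
  succ r x v = succ r y u -> F v = F u.
Hypothesis F_2cycle : forall v w, inner r v -> inner r w ->
  succ r x v = w -> succ r y w = v -> F v -> F w.

Lemma succ_in (z : nat -> bool) i j : j < r -> succ r z (NB i (j + z i)) = NP i j (z i).
Proof.
move=> jr /=; case: (z i); first by rewrite addn1.
by rewrite addn0; case: eqP => // e; move: jr; rewrite e ltnn.
Qed.

Lemma succ_out (z : nat -> bool) i j : succ r z (NP i j (~~ z i)) = NB i (j + ~~ z i).
Proof. by rewrite /=; case: (z i). Qed.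

Lemma succ_direct (z : nat -> bool) i j : ~~ detour z i j ->
  succ r z (NP i j (z i)) = NP i j (~~ z i).
Proof. by rewrite /= eqxx => /negbTE ->. Qed.

Lemma succ_detour (z : nat -> bool) i j : detour z i j ->
  succ r z (NP i j (z i)) = ND (minn i j) (maxn i j).
Proof. by rewrite /= eqxx => ->. Qed.

(** Rows read in opposite directions contain 2-cycles, which yield only implications between
    choices. Competitions for a common entry yield equalities, and these close the implications into
    cycles. *)
Lemma F_row i : i < r -> x i != y i ->
  forall v, v = NS i \/ (exists2 j, j <= r & v = NB i j) \/
    (exists2 j, j < r & exists h, v = NP i j h) -> F v = F (NS i).
Proof.
move=> ir xy.
have yi : y i = ~~ x i by case: (x i) xy; case: (y i).
have r0 : 0 < r by lia.
have BP j : j < r -> F (NB i (j + x i)) -> F (NP i j (x i)).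
  move=> jr; apply: F_2cycle.
  - by rewrite /= ir leq_add_bool.
  - by rewrite /= ir.
  - exact: succ_in.
  - by rewrite /= yi; case: (x i).
have PB j : j < r -> F (NP i j (~~ x i)) -> F (NB i (j + ~~ x i)).
  move=> jr; apply: F_2cycle.
  - by rewrite /= ir.
  - by rewrite /= ir leq_add_bool.
  - exact: succ_out.
  - by rewrite -yi; exact: succ_in.
(* The two exits compete for the entry of [NB i j.+1]. *)
have PP j : j.+1 < r -> F (NP i j true) = F (NP i j.+1 false).
  move=> jr; have jr' : j < r by lia.
  case E: (x i); [symmetry|]; apply: F_in; rewrite /= ?ir ?jr ?jr' ?yi ?E //=;
    solve [by rewrite ?addn0 ?addn1 | by apply/eqP; case; lia].
(* At the ends of the row, [NS i] competes with the outermost [NP] nodes, here for [NB i 0] and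
   below for [NB i r]. *)
have SP0 : F (NS i) = F (NP i 0 false).
  case E: (x i); [symmetry|]; apply: F_in; rewrite /= ?ir ?r0 ?yi ?E //=.
have SPr : F (NS i) = F (NP i r.-1 true).
  have rr : r.-1 < r by lia.
  by case E: (x i); [|symmetry]; apply: F_in; rewrite /= ?ir ?rr ?yi ?E //= addn1 prednK.
(* One bit vector leaves the row at [NB i 0] and the other at [NB i r], both towards [NS i.+1]. *)
have BB : F (NB i 0) = F (NB i r).
  have r0' : r == 0 = false by lia.
  by case E: (x i); [|symmetry]; apply: F_in;
   rewrite /= ?ir ?leqnn ?yi ?E //= ?eqxx //; apply/eqP; case; lia.
have Pf j : j < r -> F (NP i j false) = F (NB i j) /\ F (NP i j true) = F (NB i j.+1).
  (* If [x i] is false, the choice passes from [NP i k true] to [NB i k.+1] and on to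
     [NP i k.+1 false], which agrees with [NP i k true] by [PP]. The other direction is the mirror
     image. *)
  have step k : k.+1 < r -> F (NB i k.+1) = F (NP i k true).
    move=> kr; have kr' : k < r by lia.
    have := PB _ kr; have := BP _ kr'; have := PB _ kr'; have := BP _ kr; have := PP _ kr.
    case: (x i); rewrite /= ?addn0 ?addn1 => -> A B C D; apply/idP/idP; auto.
  (* Here the implications at the two ends of the row are closed into a cycle by [SP0], [SPr] and
     [BB]. *)
  have ends : F (NB i 0) = F (NS i) /\ F (NB i r) = F (NS i).
    rewrite BB; split;
    (have rr : r.-1 < r by lia);
    have := BP _ r0; have := PB _ r0; have := BP _ rr; have := PB _ rr;
    rewrite -?SP0 -?SPr; case: (x i); rewrite /= ?addn0 ?addn1 ?prednK // -?SP0 -?SPr ?BB => A B C D;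
    apply/idP/idP; auto.
  move=> jr; split.
    case: j jr => [|j] jr; first by rewrite -SP0; case: ends.
    by rewrite -PP // step.
  case: (ltnP j.+1 r) => h; first by rewrite step.
  have -> : j = r.-1 by lia.
  by rewrite -SPr prednK //; case: ends.
have B0 j : j <= r -> F (NB i j) = F (NB i 0).
  elim: j => // j IH jr; rewrite -IH; last by lia.
  have [Pf0 Pf1] := Pf _ jr.
  have Pa : F (NP i j (x i)) = F (NB i (j + x i)) by case: (x i); rewrite ?addn0 ?addn1.
  have Pb : F (NP i j (~~ x i)) = F (NB i (j + ~~ x i)) by case: (x i); rewrite ?addn0 ?addn1.
  (* If [x] or [y] crosses column [j] without a detour, two exits compete for an [NP] node of this
     column; if both make the detour, they compete for the [ND] node. *)
  have key : F (NB i (j + x i)) = F (NB i (j + ~~ x i)).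
    case dx: (detour x i j); last first.
      rewrite -Pa; apply: F_in; rewrite ?succ_direct ?dx // -?yi ?succ_in //= ?ir //.
      exact: leq_add_bool.
    case dy: (detour y i j); last first.
      rewrite -Pb -yi; apply: F_in; [by rewrite /= ir leq_add_bool|by rewrite /= ir|by []|].
      by rewrite succ_in // succ_direct ?dy // yi negbK.
    rewrite -Pa -Pb -yi; apply: F_in; [by rewrite /= ir|by rewrite /= ir| |by rewrite !succ_detour].
    by rewrite yi; apply/eqP => -[]; case: (x i).
  by move: key; case: (x i); rewrite /= ?addn0 ?addn1.
have S0 : F (NS i) = F (NB i 0) by rewrite SP0; case: (Pf _ r0).
move=> v [->//|[[j jr ->]|[j jr [h ->]]]]; rewrite S0; first exact: B0.
have [Pf0 Pf1] := Pf _ jr.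
by case: h; rewrite ?Pf0 ?Pf1 B0 // ltnW.
Qed.

Lemma F_row_P i j h : i < r -> j < r -> x i != y i -> F (NP i j h) = F (NS i).
Proof. by move=> ir jr xy; apply: F_row => //; right; right; exists j => //; exists h. Qed.

Lemma F_row_B i j : i < r -> j <= r -> x i != y i -> F (NB i j) = F (NS i).
Proof. by move=> ir jr xy; apply: F_row => //; right; left; exists j. Qed.

Lemma detour_lt (z : nat -> bool) i j : i < j -> detour z i j = ~~ z i.
Proof. by rewrite /detour => ->. Qed.

Lemma detour_gt (z : nat -> bool) i j : i < j -> detour z j i = z i.
Proof. by move=> ij; rewrite /detour ij ltnNge (ltnW ij). Qed.

Lemma succ_ND_lo (z : nat -> bool) i j : i < j -> ~~ z i -> succ r z (NP i j (z i)) = ND i j.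
Proof.
by move=> ij zi; rewrite succ_detour ?detour_lt // (minn_idPl (ltnW ij)) (maxn_idPr (ltnW ij)).
Qed.

Lemma succ_ND_hi (z : nat -> bool) i j : i < j -> z i -> succ r z (NP j i (z j)) = ND i j.
Proof.
by move=> ij zi; rewrite succ_detour ?detour_gt // (minn_idPr (ltnW ij)) (maxn_idPl (ltnW ij)).
Qed.

(* The traversals of x and of y reach ND i j from different rows. *)
Lemma F_cross i j : i < j -> j < r -> x i != y i ->
  F (NP i j (if x i then y i else x i)) = F (NP j i (if x i then x j else y j)).
Proof.
move=> ij jr xy; have ir : i < r by lia.
have ne a b : NP i j a != NP j i b by apply/eqP; case; lia.
have inP : inner r (NP i j (x i)) /\ inner r (NP j i (x i)) by rewrite /= ir jr.
case: inP => inij inji.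
case E: (x i) xy => xy; [symmetry|]; apply: F_in => //; rewrite 1?eq_sym ?ne //.
- by rewrite succ_ND_hi // succ_ND_lo //; case: (y i) xy.
- by rewrite -E succ_ND_lo ?E // succ_ND_hi //; case: (y i) xy.
Qed.

Lemma F_coupled i j : i < r -> j < r -> x i != y i -> x j != y j -> F (NS i) = F (NS j).
Proof.
wlog ij : i j / i < j.
  by move=> W ir jr xi xj; case: (ltngtP i j) => [h|h|-> //]; [apply: W|symmetry; apply: W].
move=> ir jr xi xj; have := F_cross ij jr xi.
by rewrite !F_row_P.
Qed.

(** Rows with different bits agree by [F_coupled]. In a row with equal bits an [NP] node moves only
    where a smaller row with different bits decides the detour, and [F_cross] carries the choice
    over. A moved [ND] node competes with a node whose choice is already known. *)
Lemma F_moved i : i < r -> x i != y i ->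
  forall v, inner r v -> succ r x v != succ r y v -> F v = F (NS i).
Proof.
move=> ir xyi.
have C j : j < r -> x j != y j -> F (NS j) = F (NS i) by move=> *; apply: F_coupled.
have S j : x j = y j \/ x j != y j by case: eqP; [left|right].
case=> [j|j k|j k h|j k] /= vin.
- by case: (S j) => [->|xy _]; [rewrite eqxx|exact: C].
- case/andP: vin => jr kr.
  by case: (S j) => [->|xy _]; [rewrite eqxx|rewrite F_row_B // C].
- case/andP: vin => jr kr.
  case: (S j) => [e|xy _]; last by rewrite F_row_P // C.
  rewrite -e; case: (eqVneq h (x j)) => [hE|]; last by rewrite eqxx.
  case: (ltnP j k) => jk; first by rewrite !detour_lt // e eqxx.
  case: (eqVneq j k) => [->|njk]; first by rewrite /detour ltnn eqxx.
  have kj : k < j by lia.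
  rewrite !detour_gt //; case: (S k) => [->|xk _]; first by rewrite eqxx.
  have := F_cross kj jr xk; rewrite F_row_P // C // => ->.
  by congr F; rewrite hE; congr NP; case: ifP; rewrite ?e.
- case/andP: vin => jk kr; have jr : j < r by lia.
  case: (S j) => [e|xj].
    rewrite -e; case xjE: (x j); last by rewrite eqxx.
    case: (S k) => [->|xk _]; first by rewrite eqxx.
    rewrite -(C k) // -(@F_row_B k (j + y k)) //; last exact: leq_add_bool.
    apply: F_in; rewrite //= ?kr ?jk //=.
      exact: leq_add_bool.
    have := succ_in y k jr; rewrite /= => ->; rewrite xjE.
    by congr NP; case: (x k) xk; case: (y k).
  move=> _; case xjE: (x j); last first.
    have yj : y j by move: xj; rewrite xjE; case: (y j).
    rewrite -(C j) // -(@F_row_B j k.+1) //.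
    apply: F_in; rewrite //= ?kr ?jk ?jr //=.
    by rewrite xjE yj.
  have yj : y j = false by move: xj; rewrite xjE; case: (y j).
  case: (S k) => [ek|xk]; last first.
    rewrite -(C k) // -(@F_row_B k (j + y k)) //; last exact: leq_add_bool.
    apply: F_in; rewrite //= ?kr ?jk //=.
      exact: leq_add_bool.
    have := succ_in y k jr; rewrite /= => ->; rewrite xjE.
    by congr NP; case: (x k) xk; case: (y k).
  (* Row [k] keeps its direction and under [y] crosses column [j] directly, so [ND j k] competes
     with [NP k j (x k)]. *)
  have := F_cross jk kr xj; rewrite F_row_P // C // => ->; rewrite xjE.
  apply: F_in; rewrite //= ?kr ?jk ?jr //=.
by rewrite ek eqxx detour_gt // xjE yj.
Qed.
End Choice.

(** * The traversal as a list of nodes *)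

(** Only the columns below [k] are listed, so that one induction serves both directions: the list
    starts at [NB i k] if [x i] holds and ends there otherwise. *)
Fixpoint row (x : nat -> bool) (i k : nat) : seq node :=
  if k is j.+1 then
    let d := nseq (detour x i j) (ND (minn i j) (maxn i j)) in
    if x i then [:: NB i k, NP i j true & d ++ NP i j false :: row x i j]
    else row x i j ++ NP i j false :: d ++ [:: NP i j true; NB i k]
  else [:: NB i 0].

Fixpoint rows (r : nat) (x : nat -> bool) (k : nat) : seq node :=
  if k is i.+1 then rows r x i ++ rcons (row x i r) (NS k) else [::].

Lemma succ_ND r x i j : detour x i j ->
  succ r x (ND (minn i j) (maxn i j)) = NP i j (~~ x i).
Proof.
rewrite /detour; case: (ltngtP i j) => //= ij => [/negbTE -> //|xj].
by rewrite xj.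
Qed.

Lemma row_path r x i k z : k <= r -> succ r x z = NB i (if x i then k else 0) ->
  fpath (succ r x) z (row x i k) /\ last z (row x i k) = NB i (if x i then 0 else k).
Proof.
case xi: (x i); elim: k z => [|k IH] z kr zE /=; rewrite ?xi.
- by rewrite zE eqxx.
- have [||p l] := IH (NP i k false); [exact: ltnW|by rewrite /= xi addn0|].
  rewrite /= zE eqxx xi eqxx last_cat cat_path /= p l.
  case dE: (detour x i k); rewrite /= xi dE ?eqxx //=.
  by have := @succ_ND r x i k dE; rewrite /= xi => ->; rewrite !eqxx.
- by rewrite zE eqxx.
- have [||p l] := IH z; [exact: ltnW|by []|].
  rewrite cat_path p l last_cat /= last_cat /= xi ltn_eqF //= eqxx cat_path /=.
  case dE: (detour x i k); rewrite /= xi ?dE /= ?addn1 ?eqxx //.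
  by have := @succ_ND r x i k dE; rewrite /= xi => ->; rewrite !eqxx.
Qed.

Lemma rows_path r x k : k <= r ->
  fpath (succ r x) (NS 0) (rows r x k) /\ last (NS 0) (rows r x k) = NS k.
Proof.
elim: k => [|k IH] kr //=; have [p l] := IH (ltnW kr).
have [//||p' l'] := @row_path r x k r (NS k); first by [].
rewrite cat_path p l rcons_path p' l' last_cat last_rcons /=.
by case: (x k); rewrite ?eqxx.
Qed.

Definition in_row (x : nat -> bool) (i k : nat) (v : node) : bool :=
  match v with
  | NS _ => false
  | NB a j => (a == i) && (j <= k)
  | NP a j _ => (a == i) && (j < k)
  | ND a b => (a < b) && (if x a then (b == i) && (a < k) else (a == i) && (b < k))
  end.

Lemma NBE i j a b : (NB i j == NB a b) = (i == a) && (j == b).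
Proof. by rewrite -(inj_eq (can_inj node_codeK)). Qed.
Lemma NPE i j h a b g : (NP i j h == NP a b g) = [&& i == a, j == b & h == g].
Proof. by rewrite -(inj_eq (can_inj node_codeK)) /= andbA. Qed.
Lemma NDE i j a b : (ND i j == ND a b) = (i == a) && (j == b).
Proof. by rewrite -(inj_eq (can_inj node_codeK)). Qed.
Lemma NSE i a : (NS i == NS a) = (i == a).
Proof. by rewrite -(inj_eq (can_inj node_codeK)). Qed.
Definition nodeE := (NBE, NPE, NDE, NSE).

Lemma mem_detour x i j v :
  (v \in nseq (detour x i j) (ND (minn i j) (maxn i j))) =
  if v is ND a b then (a < b) && (if x a then (b == i) && (a == j) else (a == i) && (b == j))
  else false.
Proof.
rewrite mem_nseq; case: v => [a|a b|a b h|a b]; rewrite ?andbF //= nodeE lt0b /detour.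
apply/idP/idP.
- case/and3P=> + /eqP -> /eqP ->; case: (ltngtP i j) => //= ij; rewrite ij.
  + by move/negbTE->; rewrite !eqxx.
  + by move=> ->; rewrite !eqxx.
- case/andP=> ab; case xa: (x a) => /andP[/eqP bE /eqP aE]; rewrite -aE -bE.
  + by rewrite ltnNge (ltnW ab) /= ab xa (minn_idPr (ltnW ab)) (maxn_idPl (ltnW ab)) !eqxx.
  + by rewrite ab xa (minn_idPl (ltnW ab)) (maxn_idPr (ltnW ab)) !eqxx.
Qed.

Lemma mem_row x i k : row x i k =i in_row x i k.
Proof.
elim: k => [|k IH] v.
  by rewrite /= inE unfold_in; case: v => [a|a b|a b h|a b]; rewrite //= ?nodeE ?leqn0 ?ltn0 ?andbF ?if_same ?andbF.
have -> : (v \in row x i k.+1) = [|| v == NB i k.+1, v == NP i k true, v == NP i k false,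
    v \in nseq (detour x i k) (ND (minn i k) (maxn i k)) | v \in row x i k].
  rewrite /=; case: (x i); rewrite !(mem_cat, inE); case: (v == NB _ _); case: (v == NP _ _ true);
  by case: (v == NP _ _ false); case: (v \in row _ _ _); case: (v \in nseq _ _).
rewrite mem_detour IH !unfold_in; case: v => [a|a b|a b h|a b] //=; rewrite ?nodeE ?orbF /=.
- by rewrite -andb_orr [b <= k.+1]leq_eqVlt ltnS.
- rewrite ltnS (leq_eqVlt b); case: (a == i) => //=; case: h; case: eqP => //=.
- rewrite -andb_orr; congr andb; case: (x a); by rewrite -andb_orr -leq_eqVlt.
Qed.

Lemma row_uniq x i k : uniq (row x i k).
Proof.
elim: k => //= k IH.
have dE v : v \in nseq (detour x i k) (ND (minn i k) (maxn i k)) ->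
    (v \notin row x i k) && (if v is ND _ _ then true else false).
  rewrite mem_detour mem_row unfold_in; case: v => //= a b.
  by case/andP=> -> /=; case: (x a) => /andP[/eqP -> /eqP ->]; rewrite ltnn ?andbF.
have dU : uniq (nseq (detour x i k) (ND (minn i k) (maxn i k))) by case: detour.
have notd v : (if v is ND _ _ then false else true) ->
    v \notin nseq (detour x i k) (ND (minn i k) (maxn i k)).
  by move=> h; apply/negP => /dE; case: v h => [a|a b|a b g|a b]; rewrite ?andbF.
have notr v : ~~ in_row x i k v -> v \notin row x i k by rewrite mem_row.
have dis : ~~ has (mem (row x i k)) (nseq (detour x i k) (ND (minn i k) (maxn i k))).
  by apply/hasPn => v /dE /andP[].
have dis' : ~~ has (mem (nseq (detour x i k) (ND (minn i k) (maxn i k)))) (row x i k).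
  by apply/hasPn => v vr; apply/negP => /dE; rewrite vr.
have nB : NB i k.+1 \notin row x i k by rewrite notr //= ltnn andbF.
have nP h : NP i k h \notin row x i k by rewrite notr //= ltnn andbF.
(* This is the backward reading; the forward one is a permutation of it. *)
have U : uniq [:: NB i k.+1, NP i k true & nseq (detour x i k) (ND (minn i k) (maxn i k)) ++
    NP i k false :: row x i k].
  by rewrite /= !(cat_uniq, mem_cat, inE) /= !(negbTE (notd _ _)) // !(negbTE nB, negbTE (nP _)) dU IH
    ?nodeE ?eqxx ?andbF /= dis'.
case: (x i) => //; apply: etrans U; apply: perm_uniq.
by apply/permP => p; rewrite /= !count_cat /= count_cat /=; lia.
Qed.

Lemma mem_rows r x k : forall v, (v \in rows r x k) = match v with
  | NS i => 0 < i <= k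
  | ND _ _ => [exists i : 'I_k, in_row x i r v]
  | NB i _ | NP i _ _ => (i < k) && in_row x i r v end.
Proof.
elim: k => [|k IH] v.
  rewrite in_nil; case: v => [a|a b|a b h|a b] //=; first by case: a.
  by apply/esym/negbTE/existsPn => -[].
rewrite /= mem_cat mem_rcons inE IH mem_row unfold_in; case: v => [a|a b|a b h|a b] /=.
- rewrite nodeE orbF; lia.
- by rewrite eqxx /= -andb_orl ltnS (leq_eqVlt a) orbC.
- by rewrite eqxx /= -andb_orl ltnS (leq_eqVlt a) orbC.
- apply/idP/existsP.
    case/orP => [/existsP[i h]|h]; first by exists (widen_ord (leqnSn k) i).
    by exists ord_max.
  case=> i h; case: (ltnP i k) => ik; first by apply/orP; left; apply/existsP; exists (Ordinal ik).
  have e : i = k :> nat by have := ltn_ord i; lia.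
  by move: h; rewrite e => ->; rewrite orbT.
Qed.

Definition tour r x := NS 0 :: rows r x r.

Definition in_tour (r : nat) (v : node) : bool := inner r v || (v == NS r).

(** Whatever the bits, each [ND a b] is visited by exactly one of the rows [a] and [b]. Hence all
    traversals have the same nodes, which makes Hamiltonian paths of them. *)
Lemma mem_tour r x : tour r x =i in_tour r.
Proof.
move=> v; rewrite inE mem_rows unfold_in /in_tour; case: v => [a|a b|a b h|a b] /=; rewrite ?nodeE ?orbF ?eqxx /=.
- lia.
- by [].
- by [].
apply/existsP/idP.
  by case=> i; have := ltn_ord i; case: (x a) => ir /andP[ab /andP[/eqP e]]; rewrite ab /=; lia.
case/andP=> ab br; have ar := ltn_trans ab br.
by case xa: (x a); [exists (Ordinal br)|exists (Ordinal ar)]; rewrite /= ab eqxx.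
Qed.

Lemma rows_uniq r x k : uniq (rows r x k).
Proof.
elim: k => //= k IH; rewrite cat_uniq IH rcons_uniq row_uniq andbT /= mem_row unfold_in /= andbT.
apply/hasPn => v; rewrite mem_rcons inE mem_row unfold_in => h; rewrite mem_rows.
case: v h => [a|a b|a b h|a b] /=; rewrite ?nodeE.
- by rewrite orbF => /eqP ->; rewrite ltnn andbF.
- by case/andP=> /eqP ->; rewrite ltnn.
- by case/andP=> /eqP ->; rewrite ltnn.
- move=> h; apply/existsPn => i; apply/negP; move: h.
  by case/andP=> -> /=; case: (x a) => /andP[/eqP -> _] /andP[/eqP e _]; have := ltn_ord i; rewrite -e ltnn.
Qed.

Lemma tour_uniq r x : uniq (tour r x).
Proof. by rewrite /= rows_uniq mem_rows. Qed.

Lemma tour_path r x : fpath (succ r x) (NS 0) (rows r x r) /\ last (NS 0) (rows r x r) = NS r.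
Proof. exact: rows_path. Qed.

(** Each row has at most four nodes per column ([NB], two [NP], a detour) and one more [NB]; there
    are [r.+1] nodes [NS]. *)
Lemma size_tour r x : size (tour r x) <= 4 * r ^ 2 + 2 * r + 1.
Proof.
have sr i k : size (row x i k) <= 4 * k + 1.
  elim: k => //= k IH; case: (x i); rewrite /= !(size_cat, size_nseq) /=;
  by case: detour => /=; lia.
have sk k : size (rows r x k) <= k * (4 * r + 2).
  elim: k => //= k IH; rewrite size_cat size_rcons; have := sr k r; lia.
rewrite /=; have := sk r; lia.
Qed.

(** * Spanning trees of the complete graph *)

Lemma set2_inj (T : finType) (a b c d : T) :
  [set a; b] = [set c; d] -> (a = c /\ b = d) \/ (a = d /\ b = c).
Proof.
move=> /setP E; have := E a; have := E b; have := E c; have := E d.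
rewrite !inE !eqxx ?orbT /= => /orP dE /orP cE /esym/orP bE /esym/orP aE.
case: aE => /eqP ae; case: bE => /eqP be; subst; auto.
- by case: dE => /eqP ->; auto.
- by case: cE => /eqP ->; auto.
Qed.

Lemma Kedge_of n (a b : 'I_n) : a != b -> exists e : Kedge n, val e = [set a; b].
Proof.
move=> ab; have h : #|[set a; b]| == 2 by rewrite cards2 ab.
by exists (exist (fun e : {set 'I_n} => #|e| == 2) _ h).
Qed.

Lemma Kedge_ends n (e : Kedge n) : exists a b : 'I_n, val e = [set a; b].
Proof. by case: e => A /= /cards2P[a [b [_ ->]]]; exists a, b. Qed.

Lemma tadjP n (T : {set Kedge n}) a b :
  reflect (exists2 e, e \in T & val e = [set a; b]) (tadj T a b).
Proof.
apply: (iffP existsP) => [[e /andP[eT /eqP ve]]|[e eT ve]]; exists e => //.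
by rewrite eT ve eqxx.
Qed.

Lemma tadj_sym n (T : {set Kedge n}) : symmetric (tadj T).
Proof. by move=> a b; rewrite /tadj setUC. Qed.

Lemma tadj_neq n (T : {set Kedge n}) a b : tadj T a b -> a != b.
Proof.
case/tadjP => e _ ve; apply/eqP => ab; have := valP e.
by rewrite ve ab setUid cards1.
Qed.

Lemma tadj_sub n (A B : {set Kedge n}) a b : A \subset B -> tadj A a b -> tadj B a b.
Proof. by move=> /subsetP AB /tadjP[e eA ve]; apply/tadjP; exists e => //; apply: AB. Qed.

Lemma sub_tadj n (A B : {set Kedge n}) :
  (forall a b, tadj A a b -> tadj B a b) -> A \subset B.
Proof.
move=> AB; apply/subsetP => e eA; have [a [b ve]] := Kedge_ends e.
have /AB/tadjP[f fB vf] : tadj A a b by apply/tadjP; exists e.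
have -> : e = f by apply: val_inj; rewrite ve vf.
exact: fB.
Qed.

Lemma tadjI n (A B : {set Kedge n}) a b : tadj (A :&: B) a b = tadj A a b && tadj B a b.
Proof.
apply/tadjP/andP => [[e] | [/tadjP[e eA ve] /tadjP[f fB vf]]].
  by rewrite inE => /andP[eA eB] ve; split; apply/tadjP; exists e.
have ef : e = f by apply: val_inj; rewrite ve vf.
by exists e => //; rewrite inE eA ef.
Qed.

Lemma tadjU n (A B : {set Kedge n}) a b : tadj (A :|: B) a b = tadj A a b || tadj B a b.
Proof.
apply/idP/idP => [/tadjP[e]|].
  by rewrite inE => /orP[] h ve; apply/orP; [left|right]; apply/tadjP; exists e.
by case/orP; apply: tadj_sub; rewrite ?subsetUl ?subsetUr.
Qed.

Lemma tadjD1 n (T : {set Kedge n}) e a b :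
  tadj T a b -> [set a; b] != val e -> tadj (T :\ e) a b.
Proof.
case/tadjP => f fT vf ne; apply/tadjP; exists f => //.
by rewrite !inE fT andbT; apply: contra ne => /eqP <-; rewrite vf.
Qed.

Lemma tdegE n (T : {set Kedge n}) v : tdeg T v = #|[set w | tadj T v w]|.
Proof.
rewrite /tdeg -(card_imset _ val_inj).
have inj : injective (fun w => [set v; w]).
  by move=> a b /set2_inj[[]|[-> ->]].
rewrite -(card_imset _ inj); apply: eq_card => A.
apply/imsetP/imsetP => [[e]|[w]]; rewrite inE.
  case/andP=> eT ve AE; have [a [b ve']] := Kedge_ends e.
  move: ve; rewrite ve' !inE => /orP[] /eqP vE.
    by exists b; rewrite ?inE ?AE ?ve' ?vE //; apply/tadjP; exists e; rewrite // ve'.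
  by exists a; rewrite ?inE ?AE ?ve' ?vE 1?setUC //; apply/tadjP; exists e; rewrite // ve' setUC.
by case/tadjP=> e eT ve ->; exists e => //; rewrite inE eT ve !inE eqxx.
Qed.

Lemma tdeg_sum n (T : {set Kedge n}) : \sum_v tdeg T v = 2 * #|T|.
Proof.
rewrite /tdeg; under eq_bigr => v _ do rewrite -sum1_card.
under eq_bigr => v _ do under eq_bigl => e do rewrite inE.
rewrite (exchange_big_dep (mem T)) /=; last by move=> v e _ /andP[].
rewrite mulnC -sum_nat_const; apply: eq_bigr => e eT.
under eq_bigl => v do rewrite eT /=.
by rewrite sum1_card; apply/eqP/(valP e).
Qed.

Lemma tdeg_gt0 n (T : {set Kedge n}) v : 1 < n -> tconnected T -> 0 < tdeg T v.
Proof.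
move=> n1 conT; rewrite tdegE card_gt0.
have [u uv] : exists u : 'I_n, u != v.
  apply/existsP; rewrite -negb_forall; apply/negP => /forallP h.
  have : #|'I_n| <= #|[set v]| by apply/subset_leq_card/subsetP => u _; rewrite inE h.
  by rewrite card_ord cards1 leqNgt n1.
have /connectP[[|w p] /= + lE] := conT v u; first by rewrite lE eqxx in uv.
by case/andP=> vw _; apply/set0Pn; exists w; rewrite inE.
Qed.

(** A connected part of [T] is grown from [ord0], one vertex and one edge at a time. Once it reaches
    every vertex, an edge of [T] outside it would lie on a cycle. *)
Lemma tree_card n (T : {set Kedge n}) : 0 < n -> spanning_tree T -> #|T| <= n.-1.
Proof.
case: n T => // n T _ [conT acT] /=.
have grow k : k <= n -> exists (S : {set 'I_n.+1}) (P : {set Kedge n.+1}),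
    [/\ #|S| = k.+1, #|P| <= k, P \subset T, ord0 \in S &
        forall s, s \in S -> connect (tadj P) ord0 s].
  elim: k => [|k IH] kn.
    exists [set ord0], set0; split; rewrite ?cards1 ?cards0 ?sub0set ?set11 //.
    by move=> s; rewrite inE => /eqP ->.
  have [S [P [cS cP PT S0 con]]] := IH (ltnW kn).
  have [v vS] : exists v, v \notin S.
    apply/existsP; rewrite -negb_forall; apply/negP => /forallP h.
    have : #|'I_n.+1| <= #|S| by apply/subset_leq_card/subsetP => u _; rewrite h.
    by rewrite card_ord cS; lia.
  (* A walk in [T] from [ord0] to [v] has to leave [S] somewhere. *)
  have [a [b [aS bS ab]]] : exists a b, [/\ a \in S, b \notin S & tadj T a b].
    have /connectP[p] := conT ord0 v.
    elim: p (ord0) S0 => [|w p IHp] z zS /=; first by move=> _ e; rewrite e zS in vS.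
    case/andP=> zw pw lv; case wS: (w \in S); last by exists z, w; rewrite wS.
    exact: IHp pw lv.
  case/tadjP: ab => e eT ve.
  exists (b |: S), (e |: P); split.
  - by rewrite cardsU1 bS cS.
  - by rewrite cardsU1 -[k.+1]add1n; apply: leq_add cP; exact: leq_b1.
  - by rewrite subUset sub1set eT.
  - by rewrite inE S0 orbT.
  - have lift x z : connect (tadj P) x z -> connect (tadj (e |: P)) x z.
      by apply: connect_sub => c d h; apply/connect1/(tadj_sub _ h)/subsetUr.
    move=> s; rewrite !inE => /orP[/eqP ->|/con/lift //].
    apply: connect_trans (lift _ _ (con _ aS)) (connect1 _).
    by apply/tadjP; exists e; rewrite ?inE ?eqxx.
have [S [P [cS cP PT S0 con]]] := grow n (leqnn n).
have ST s : s \in S.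
  have -> : S = setT by apply/eqP; rewrite eqEcard subsetT cardsT card_ord cS /=.
  by rewrite inE.
suff /subset_leq_card le : T \subset P by exact: leq_trans le cP.
apply/subsetP => e eT; apply/negPn/negP => eP.
have [a [b ve]] := Kedge_ends e.
have /negP := acT e eT a b ve; apply.
have lift x z : connect (tadj P) x z -> connect (tadj (T :\ e)) x z.
  apply: connect_sub => c d h; apply/connect1/(tadj_sub _ h).
  by apply/subsetP => f fP; rewrite !inE (subsetP PT) // andbT; apply: contraNneq eP => <-.
have symP : connect_sym (tadj P) by apply/sym_connect_sym/tadj_sym.
by apply/lift; rewrite (connect_trans (_ : connect _ a ord0)) ?con // symP con.
Qed.

(** The ends of an edge of [T] outside [H] are already connected in [H], so this edge would lie on a
    cycle of [T]. *)
Lemma tree_sub_eq n (H T : {set Kedge n}) : tconnected H -> tacyclic T -> H \subset T -> T = H.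
Proof.
move=> conH acT HT; apply/eqP; rewrite eq_sym eqEsubset HT /=.
apply/subsetP => e eT; apply/negPn/negP => eH.
have [a [b ve]] := Kedge_ends e.
have /negP := acT e eT a b ve; apply; apply: (connect_sub _ (conH a b)) => c d h.
apply/connect1/(tadj_sub _ h).
by apply/subsetP => f fP; rewrite !inE (subsetP HT) // andbT; apply: contraNneq eH => <-.
Qed.

Lemma no_4cycle n (T : {set Kedge n}) a b c d : tacyclic T -> a != c -> b != d ->
  tadj T a b -> tadj T b c -> tadj T c d -> tadj T d a -> False.
Proof.
move=> acT ac bd ab bc cd da; case/tadjP: (ab) => e eT ve.
have /negP := acT e eT a b ve; apply.
have ne z t : tadj T z t -> (t == z) = false by move/tadj_neq; rewrite eq_sym => /negbTE.
rewrite eq_sym in ac; rewrite eq_sym in bd.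
have da_ : (d == a) = false by rewrite eq_sym (ne _ _ da).
have F := (da_, ne _ _ ab, ne _ _ bc, negbTE ac, negbTE bd).
have off z t : tadj T z t -> ~ (z = a /\ t = b) -> ~ (z = b /\ t = a) -> tadj (T :\ e) t z.
  move=> zt n1 n2; rewrite tadj_sym; apply: tadjD1 => //; rewrite ve.
  by apply/eqP => /set2_inj[].
have ad' : tadj (T :\ e) a d.
  by apply: off => // -[/eqP + /eqP]; rewrite ?F.
have dc' : tadj (T :\ e) d c.
  by apply: off => // -[/eqP + /eqP]; rewrite ?F.
have cb' : tadj (T :\ e) c b.
  by apply: off => // -[/eqP + /eqP]; rewrite ?F.
exact: connect_trans (connect1 ad') (connect_trans (connect1 dc') (connect1 cb')).
Qed.

(** The degrees sum to at most 2(n-1). The vertices off [u1] and [u2] contribute at least 2(n-2),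
    and these two at least 1 each by connectedness, so there is no slack. *)
Lemma tree_degrees n (T : {set Kedge n}) u1 u2 : u1 != u2 -> spanning_tree T ->
  (forall v, v != u1 -> v != u2 -> 1 < tdeg T v) ->
  forall v, v != u1 -> v != u2 -> tdeg T v = 2.
Proof.
move=> u12 sT deg v v1 v2; case: (sT) => conT _.
have n1 : 1 < n.
  have := max_card (mem [set u1; u2]); rewrite cards2 u12 card_ord; exact.
have := tdeg_sum T; have := tree_card (ltnW n1) sT.
have [d1 d2] : 0 < tdeg T u1 /\ 0 < tdeg T u2 by split; exact: tdeg_gt0.
rewrite (bigD1 u1) // (bigD1 u2) 1?eq_sym //= (bigD1 v) /=; last by rewrite v1.
have rest : 2 * (n - 3) <= \sum_(i < n | (i != u1) && (i != u2) && (i != v)) tdeg T i.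
  have cE : #|[pred i : 'I_n | (i != u1) && (i != u2) && (i != v)]| = n - 3.
    have -> : #|[pred i : 'I_n | (i != u1) && (i != u2) && (i != v)]| = #|~: [set u1; u2; v]|.
      by apply: eq_card => i; rewrite !inE !negb_or.
    have c3 : #|[set u1; u2; v]| = 3.
      by rewrite setUC cardsU1 cards2 u12 !inE negb_or v1 v2.
    by rewrite -[in RHS](card_ord n) -(cardsC [set u1; u2; v]) c3 addnC addnK.
  rewrite mulnC -cE -sum_nat_const; apply: leq_sum => i /andP[/andP[i1 i2] _]; exact: deg.
have dv := deg _ v1 v2.
have n3 : 2 < n.
  have := max_card (mem [set u1; u2; v]); rewrite card_ord.
  by rewrite setUC cardsU1 cards2 u12 !inE negb_or v1 v2.
move: rest dv d1 d2 {deg}; move: (\sum_(_ | _) _) => S.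
move: (tdeg T u1) (tdeg T u2) (tdeg T v) #|T| => a b c t; clear -n3; lia.
Qed.

(** * Hamiltonian paths as edge sets *)

(** Since [index] sends an absent vertex to [size s], the last vertex of an incomplete nonempty list
    would be joined to all absent ones. This is why later lemmas assume that [s] contains every
    vertex. *)
HB.lock Definition hpath n (s : seq 'I_n) : {set Kedge n} :=
  [set e | [exists a, exists b, (val e == [set a; b]) && (index b s == (index a s).+1)]].

Lemma tadj_hpath n (s : seq 'I_n) a b : tadj (hpath s) a b =
  (index b s == (index a s).+1) || (index a s == (index b s).+1).
Proof.
apply/tadjP/idP => [[e]|].
  rewrite hpath.unlock inE => /existsP[c /existsP[d /andP[/eqP -> /eqP h]]] /esym/set2_inj[[-> ->]|[-> ->]];
  by rewrite h eqxx ?orbT.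
have ne : (index b s == (index a s).+1) || (index a s == (index b s).+1) -> a != b.
  by apply: contraL => /eqP ->; rewrite orbb ltn_eqF.
move=> h; have [e ve] := Kedge_of (ne h); exists e => //; rewrite hpath.unlock inE.
case/orP: h => h; apply/existsP.
  by exists a; apply/existsP; exists b; rewrite ve eqxx.
by exists b; apply/existsP; exists a; rewrite ve setUC eqxx.
Qed.

Lemma index_eq (T : eqType) (s l r : seq T) v z : uniq s -> z \in s -> s = l ++ v :: r ->
  (index z s == size l) = (z == v).
Proof.
move=> us zs sE; have vl : index v s = size l.
  by move: us; rewrite sE cat_uniq index_cat /= eqxx addn0 => /and3P[_ /norP[/negbTE -> _] _].
rewrite -vl; apply/eqP/eqP => [h|-> //].
by rewrite -(nth_index v zs) h nth_index // sE mem_cat inE eqxx orbT.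
Qed.

Lemma hpath_nbrs n (s l r : seq 'I_n) a v c z : uniq s -> (forall u, u \in s) ->
  s = l ++ [:: a, v, c & r] -> tadj (hpath s) v z = (z == a) || (z == c).
Proof.
move=> us cov sE; rewrite tadj_hpath.
have sE' : s = rcons l a ++ v :: c :: r by rewrite sE cat_rcons.
have sE'' : s = rcons (rcons l a) v ++ c :: r by rewrite sE' !cat_rcons.
have := index_eq us (cov v) sE'; rewrite eqxx size_rcons => /eqP ->.
have := index_eq us (cov z) sE''; rewrite !size_rcons => ->.
by rewrite orbC eqSS eq_sym (index_eq us (cov z) sE).
Qed.

Lemma hpath_tree n (s : seq 'I_n) : uniq s -> (forall u, u \in s) -> spanning_tree (hpath s).
Proof.
move=> us cov; have sym := sym_connect_sym (@tadj_sym n (hpath s)); split.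
  case: s us cov sym => [|x p] us cov sym u v; first by have := cov u.
  have pth : path (tadj (hpath (x :: p))) x p.
    apply/(pathP x) => i ip; rewrite tadj_hpath.
    have -> : nth x p i = nth x (x :: p) i.+1 by [].
    have -> : index (nth x (x :: p) i.+1) (x :: p) = i.+1 by apply: index_uniq us.
    have -> : index (nth x (x :: p) i) (x :: p) = i by apply: index_uniq us; exact: ltnW.
    by rewrite eqxx.
  have c z : connect (tadj (hpath (x :: p))) x z by apply: (path_connect pth).
  by apply: connect_trans (c v); rewrite sym.
move=> e eH u v ve.
wlog vu : u v ve / index v s = (index u s).+1.
  move=> W; have : tadj (hpath s) u v by apply/tadjP; exists e.
  rewrite tadj_hpath => /orP[/eqP|/eqP h]; first exact: W.
  rewrite (sym_connect_sym (@tadj_sym n _)); apply: W h; by rewrite ve setUC.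
apply/negP => con.
(* Once the edge between [u] and [v] is removed, no edge leaves the initial segment of [s] ending at
   [u]. *)
have cl : closed (tadj (hpath s :\ e)) [pred z | index z s <= index u s].
  move=> a b ab; rewrite !inE.
  have nab : [set a; b] != [set u; v].
    case/tadjP: ab => f; rewrite !inE => /andP[fe _] vf.
    by rewrite -vf -ve; apply: contra fe => /eqP/val_inj ->.
  have {}ab : tadj (hpath s) a b by apply: tadj_sub ab; exact: subD1set.
  have iinj (z t : 'I_n) : index z s = index t s -> z = t.
    by move=> h; rewrite -(nth_index z (cov z)) h nth_index.
  move: ab; rewrite tadj_hpath => /orP[] /eqP h; rewrite h ltn_neqAle.
  - have -> // : index a s != index u s.
    apply: contra nab => /eqP E; rewrite (iinj _ _ E) (iinj b v) //.
    by rewrite h E vu.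
  - have -> // : index b s != index u s.
    apply: contra nab => /eqP E; rewrite (iinj _ _ E) (iinj a v) 1?setUC //.
    by rewrite h E vu.
have := closed_connect cl con; rewrite !inE vu leqnn ltnn.
by [].
Qed.

Lemma hpath_deg n (s l r : seq 'I_n) a v c : uniq s -> (forall u, u \in s) ->
  s = l ++ [:: a, v, c & r] -> tdeg (hpath s) v = 2.
Proof.
move=> us cov sE; rewrite tdegE.
rewrite (_ : [set w | _] = [set a; c]).
  rewrite cards2; move: us; rewrite sE cat_uniq => /and3P[_ _] /=.
  by rewrite !inE !negb_or => /andP[/and3P[_ -> _] _].
by apply/setP => z; rewrite !inE (hpath_nbrs _ us cov sE).
Qed.

Lemma split_mid (T : eqType) (s : seq T) x y v : v \in s ->
  exists l r a c, x :: rcons s y = l ++ [:: a, v, c & r].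
Proof.
case/splitPr => p q.
have [l [a e1]] : exists l a, x :: p = rcons l a by case/lastP: p => [|p a]; [exists [::], x|exists (x :: p), a].
have [c [r e2]] : exists c r, rcons q y = c :: r by case: q => [|c q]; [exists y, [::]|exists c, (rcons q y)].
by exists l, r, a, c; rewrite rcons_cat rcons_cons e2 -cat_cons e1 cat_rcons.
Qed.

Lemma hpath_leaves n (U : {set 'I_n}) (s : seq 'I_n) u1 u2 :
  let p := u1 :: rcons s u2 in
  uniq p -> (forall u, u \in p) -> u1 \in U -> u2 \in U -> leaves_in (hpath p) U.
Proof.
move=> p up cov U1 U2 v dv; have := cov v; rewrite /p inE mem_rcons inE.
case/or3P => [/eqP -> //|/eqP -> //|vs].
have [l [r [a [c e]]]] := split_mid u1 u2 vs.
by have := hpath_deg up cov e; rewrite dv.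
Qed.

(** * The family of Hamiltonian paths *)

Lemma consecutive_eq (T : eqType) (s l r l' r' : seq T) a a' b : uniq s ->
  s = l ++ [:: a, b & r] -> s = l' ++ [:: a', b & r'] -> a = a'.
Proof.
move=> us sE sE'; have bs : b \in s by rewrite sE mem_cat !inE eqxx !orbT.
have sF := sE; have sF' := sE'; rewrite -cat_rcons in sF; rewrite -cat_rcons in sF'.
have := index_eq us bs sF; have := index_eq us bs sF'; rewrite eqxx => /eqP ->.
rewrite !size_rcons eqSS => /eqP ll.
have as_ : a \in s by rewrite sE mem_cat inE eqxx orbT.
have := index_eq us as_ sE; rewrite eqxx -ll => h.
by apply/eqP; rewrite -(index_eq us as_ sE') h.
Qed.

Lemma hpath_sub n (s : seq 'I_n) u (T : {set Kedge n}) : uniq s -> (forall v, v \in s) ->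
  last u s = u ->
  (forall a, a != u -> exists b l r, s = l ++ [:: a, b & r] /\ tadj T a b) -> hpath s \subset T.
Proof.
move=> us cov lu nxt; apply: sub_tadj.
have main a b : index b s == (index a s).+1 -> tadj T a b.
  move=> h; have au : a != u.
    apply: contraTneq h => ->.
    have [m sE] : exists m, s = m ++ [:: u].
      case/lastP: s cov lu {us nxt} => [cov|m v _]; first by have := cov u.
      by rewrite last_rcons => ->; exists m; rewrite cats1.
    have iu := index_eq us (cov u) sE; rewrite eqxx in iu.
    have := cov b; rewrite -index_mem (eqP iu) {2}sE size_cat addn1 ltnS.
    by rewrite leqNgt; apply: contra => /eqP ->.
  have [b' [l [r [sE ab]]]] := nxt a au.
  have := index_eq us (cov a) sE; rewrite eqxx => /eqP ia.
  rewrite -cat_rcons in sE; have := index_eq us (cov b) sE.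
  by rewrite size_rcons -ia h => /esym/eqP ->.
by move=> a b; rewrite tadj_hpath => /orP[/main //|/main]; rewrite tadj_sym.
Qed.

(** The edge to [c] leaves room for exactly one more edge at [z]. This is how a tree between two
    paths makes its choices. *)
Lemma deg2_xor n (T : {set Kedge n}) z a b c : tdeg T z = 2 -> tadj T z c ->
  a != b -> a != c -> b != c ->
  (forall w, tadj T z w -> [|| w == c, w == a | w == b]) -> tadj T z a = ~~ tadj T z b.
Proof.
rewrite tdegE => d zc ab ac bc sub.
case za: (tadj T z a); case zb: (tadj T z b) => //=.
  have : [set a; b; c] \subset [set w | tadj T z w].
    by apply/subsetP => w; rewrite !inE -orbA => /or3P[] /eqP ->.
  by move/subset_leq_card; rewrite d setUC cardsU1 cards2 ab !inE negb_or ![c == _]eq_sym ac bc.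
have : [set w | tadj T z w] \subset [set c].
  apply/subsetP => w; rewrite !inE => zw; case/or3P: (sub _ zw) => // /eqP wE.
    by rewrite wE za in zw.
  by rewrite wE zb in zw.
by move/subset_leq_card; rewrite d cards1.
Qed.

Lemma tour_next r x v : inner r v ->
  exists l s, tour r x = l ++ [:: v, succ r x v & s].
Proof.
move=> vin; have [p lst] := tour_path r x.
have vt : v \in tour r x by rewrite mem_tour unfold_in vin.
have vr : v != NS r by apply: contraTneq vin => ->; rewrite /= ltnn.
move: p lst; rewrite /tour in vt *.
move: (NS 0) (rows r x r) vt => z s; elim: s z => [|w s IH] z.
  by rewrite inE => /eqP <- _ /= e; rewrite e eqxx in vr.
rewrite inE => /orP[/eqP <-|ws] /= /andP[/eqP zw p] lst.
  by exists [::], s; rewrite zw.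
by have [l [q ->]] := IH w ws p lst; exists (z :: l), q.
Qed.

Lemma tour_last r x : exists l, tour r x = rcons l (NS r).
Proof.
have [_ lst] := tour_path r x; rewrite /tour lastI lst; by eexists.
Qed.

(* A node is doubled into its entry (_, false) and its exit (_, true). *)
Definition dbl (s : seq node) : seq (node * bool) :=
  flatten [seq [:: (v, false); (v, true)] | v <- s].

Lemma dbl_cat s t : dbl (s ++ t) = dbl s ++ dbl t.
Proof. by rewrite /dbl map_cat flatten_cat. Qed.

Lemma mem_dbl s w : (w \in dbl s) = (w.1 \in s).
Proof.
case: w => w h /=; elim: s => //= v s IH.
rewrite /dbl /= -/(dbl s) !inE IH !xpair_eqE orbA -andb_orr.
by case: (h); rewrite andbT.
Qed.

Lemma dbl_uniq s : uniq s -> uniq (dbl s).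
Proof.
elim: s => //= v s IH /andP[vs us]; rewrite /dbl /= -/(dbl s) !inE !mem_dbl /= IH //.
by rewrite xpair_eqE andbF (negbTE vs).
Qed.

Section Ham.
Variables (n : nat) (U : {set 'I_n}) (u1 u2 : 'I_n) (r : nat) (emb : node * bool -> 'I_n).
Hypotheses (U1 : u1 \in U) (U2 : u2 \in U) (u12 : u1 != u2).
Hypothesis emb_inj : {in [pred w | in_tour r w.1] &, injective emb}.
Hypothesis embU : forall w, in_tour r w.1 -> emb w \notin U.

Definition body (x : nat -> bool) : seq 'I_n := map emb (dbl (tour r x)).

(** The vertices off the gadget, among them all of [U] except [u1] and [u2], come in one fixed
    order, so their edges are common to all the paths. By [mem_body] any bit vector could stand for
    [xpred0]. *)
Definition rest : seq 'I_n :=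
  [seq v <- enum 'I_n | v \notin u1 :: u2 :: body xpred0].

Definition ham x : seq 'I_n := u1 :: rcons (body x ++ rest) u2.

Lemma mem_body x v : (v \in body x) = (v \in body xpred0).
Proof.
apply: eq_mem_map => w; by rewrite !mem_dbl !mem_tour.
Qed.

Lemma body_notin x v : v \in U -> v \notin body x.
Proof.
move=> vU; apply/negP => /mapP[w]; rewrite mem_dbl mem_tour => wt vE.
by have := embU wt; rewrite -vE vU.
Qed.

Lemma mem_rest x v : (v \in rest) = [&& v != u1, v != u2 & v \notin body x].
Proof. by rewrite mem_filter mem_enum andbT 2!in_cons -(mem_body x) !negb_or. Qed.

Lemma ham_uniq x : uniq (ham x).
Proof.
have r1 : u1 \notin rest by rewrite (mem_rest x) eqxx.
have r2 : u2 \notin rest by rewrite (mem_rest x) eqxx andbF.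
rewrite /ham cons_uniq mem_rcons in_cons (negbTE u12) mem_cat (negbTE (body_notin x U1)) (negbTE r1).
rewrite rcons_uniq mem_cat (negbTE (body_notin x U2)) (negbTE r2) cat_uniq !andTb.
rewrite filter_uniq ?enum_uniq // andbT map_inj_in_uniq.
  rewrite dbl_uniq ?tour_uniq //; apply/hasPn => v; rewrite (mem_rest x).
  by case/and3P.
move=> a b; rewrite !mem_dbl !mem_tour; exact: emb_inj.
Qed.

Lemma ham_cover x v : v \in ham x.
Proof.
rewrite in_cons mem_rcons in_cons mem_cat (mem_rest x).
by case: (v == u1); case: (v == u2); case: (v \in body _).
Qed.

Local Notation H x := (hpath (ham x)).

Lemma ham_tree x : spanning_tree (H x).
Proof. exact: hpath_tree (ham_uniq x) (@ham_cover x). Qed.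

Lemma ham_leaves x : leaves_in (H x) U.
Proof. exact: hpath_leaves (ham_uniq x) (@ham_cover x) U1 U2. Qed.

Lemma ham_infix x l s t : tour r x = l ++ s ++ t ->
  exists l' t', ham x = l' ++ map emb (dbl s) ++ t'.
Proof.
move=> tE; exists (u1 :: map emb (dbl l)), (map emb (dbl t) ++ rcons rest u2).
by rewrite /ham /body tE !dbl_cat !map_cat rcons_cat /= !catA.
Qed.

Lemma ham_edge x v : in_tour r v ->
  exists l s, ham x = l ++ [:: emb (v, false), emb (v, true) & s].
Proof.
move=> vin; have vt : v \in tour r x by rewrite mem_tour.
have [l [s tE]] : exists l s, tour r x = l ++ [:: v] ++ s.
  by case/splitPr: vt => l s; exists l, s.
have [l' [s' E]] := ham_infix tE; exists l', s'; exact: E.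
Qed.

Lemma ham_next x v : inner r v -> exists l s, ham x =
  l ++ [:: emb (v, false), emb (v, true), emb (succ r x v, false), emb (succ r x v, true) & s].
Proof.
move=> vin; have [l [s tE]] := tour_next x vin.
have [l' [s' E]] := @ham_infix x l [:: v; succ r x v] s tE; exists l', s'; exact: E.
Qed.

Lemma ham_rest x : exists l, ham x = l ++ emb (NS r, true) :: rcons rest u2.
Proof.
have [l tE] := tour_last r x.
exists (u1 :: map emb (dbl l) ++ [:: emb (NS r, false)]).
by rewrite /ham /body tE -(cats1 l) dbl_cat map_cat -catA rcons_cat /= -catA.
Qed.

Lemma adj_infix x a b l s : ham x = l ++ [:: a, b & s] -> tadj (H x) a b.
Proof.
move=> sE; rewrite tadj_hpath.
have := index_eq (ham_uniq x) (ham_cover x a) sE; rewrite eqxx => /eqP ->.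
rewrite -cat_rcons in sE.
by have := index_eq (ham_uniq x) (ham_cover x b) sE; rewrite eqxx size_rcons => /eqP ->; rewrite eqxx.
Qed.

Lemma nbrs_out x v w : inner r v ->
  tadj (H x) (emb (v, true)) w = (w == emb (v, false)) || (w == emb (succ r x v, false)).
Proof.
by move=> /(ham_next x)[l [s E]]; apply: hpath_nbrs (ham_uniq x) (@ham_cover x) E.
Qed.

Lemma nbrs_in x v w : inner r v ->
  tadj (H x) (emb (succ r x v, false)) w =
  (w == emb (v, true)) || (w == emb (succ r x v, true)).
Proof.
move=> /(ham_next x)[l [s E]]; rewrite -cat_rcons in E.
exact: hpath_nbrs (ham_uniq x) (@ham_cover x) E.
Qed.

Lemma succ_in_tour x v : inner r v -> in_tour r (succ r x v).
Proof.
move=> /(tour_next x)[l [s E]]; suff : succ r x v \in tour r x by rewrite mem_tour.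
by rewrite E mem_cat !inE eqxx !orbT.
Qed.

Lemma succ_neq x v : inner r v -> succ r x v != v.
Proof.
move=> /(tour_next x)[l [s E]]; have := tour_uniq r x; rewrite E cat_uniq.
by case/and3P=> _ _ /= /andP[]; rewrite inE negb_or eq_sym => /andP[].
Qed.

Lemma succ_inj x v u : inner r v -> inner r u -> succ r x v = succ r x u -> v = u.
Proof.
move=> /(tour_next x)[l [s E]] /(tour_next x)[l' [s' E']] e; rewrite -e in E'.
exact: consecutive_eq (tour_uniq r x) E E'.
Qed.

Lemma inner_tour v : inner r v -> in_tour r v.
Proof. by rewrite /in_tour => ->. Qed.

Lemma emb_neq v w h g : in_tour r v -> in_tour r w -> (v, h) != (w, g) ->
  emb (v, h) != emb (w, g).
Proof. by move=> vt wt; apply: contra => /eqP /emb_inj -> //; rewrite inE. Qed.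

(** * Trees between two paths of the family *)

Section Between.
Variables (x y : nat -> bool) (T : {set Kedge n}).
Hypotheses (sT : spanning_tree T) (lT : leaves_in T U).
Hypotheses (capT : H x :&: H y \subset T) (Tcup : T \subset H x :|: H y).

Lemma common_adj a b : tadj (H x) a b -> tadj (H y) a b -> tadj T a b.
Proof.
by move=> ax ay; apply: (tadj_sub capT); rewrite tadjI; apply/andP.
Qed.

Lemma adj_either a b : tadj T a b -> tadj (H x) a b || tadj (H y) a b.
Proof. by move=> ab; rewrite -tadjU; exact: (tadj_sub Tcup ab). Qed.

(** A vertex outside [U] is not a leaf. A vertex of [U] other than [u1] and [u2] lies in [rest],
    where both its path edges are common and hence in [T]. So [tree_degrees] applies. *)
Lemma between_deg v : v != u1 -> v != u2 -> tdeg T v = 2.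
Proof.
move: v; apply: (tree_degrees u12 sT) => v v1 v2.
have n1 : 1 < n.
  have := max_card (mem [set u1; u2]); rewrite cards2 u12 card_ord; exact.
case vU: (v \in U); last first.
  have [conT _] := sT; have := tdeg_gt0 v n1 conT.
  by have := @lT v; case: (tdeg T v) => [|[|k]] // /(_ erefl); rewrite vU.
have vr : v \in rest.
  by rewrite (mem_rest xpred0) v1 v2 body_notin.
have [l [s [a [c E]]]] := split_mid (emb (NS r, true)) u2 vr.
have ham_E z : exists l', ham z = l' ++ [:: a, v, c & s].
  by have [l' E'] := ham_rest z; exists (l' ++ l); rewrite E' E catA.
have adj z w : tadj (H z) v w = (w == a) || (w == c).
  by have [l' E'] := ham_E z; apply: hpath_nbrs (ham_uniq z) (@ham_cover z) E'.
have ac : a != c.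
  have [l' E'] := ham_E x; have := ham_uniq x; rewrite E' cat_uniq => /and3P[_ _] /=.
  by rewrite !inE !negb_or => /andP[/and3P[_ -> _] _].
have c2 : #|[set a; c]| = 2 by rewrite cards2 ac.
rewrite tdegE -c2; apply/subset_leq_card/subsetP => w.
by rewrite !inE => wac; apply: common_adj; rewrite adj.
Qed.

Lemma emb_deg w : in_tour r w.1 -> tdeg T (emb w) = 2.
Proof.
move=> /embU eU; apply: between_deg; apply: contraNneq eU => ->; exact.
Qed.

Lemma forced v : in_tour r v -> tadj T (emb (v, false)) (emb (v, true)).
Proof.
move=> vt; apply: common_adj.
  by have [l [s E]] := ham_edge x vt; apply: adj_infix E.
by have [l [s E]] := ham_edge y vt; apply: adj_infix E.
Qed.

Local Notation F v := (tadj T (emb (v, true)) (emb (succ r x v, false))).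

(** The exit of [v] has degree 2 in [T], and one of its edges is the forced edge to the entry of
    [v]. *)
Lemma out_xor v : inner r v -> succ r x v != succ r y v ->
  tadj T (emb (v, true)) (emb (succ r y v, false)) = ~~ F v.
Proof.
move=> vin ne; have vt := inner_tour vin.
have [xt yt] := (succ_in_tour x vin, succ_in_tour y vin).
apply: (@deg2_xor _ _ _ _ _ (emb (v, false))).
- exact: emb_deg.
- by rewrite tadj_sym forced.
- by rewrite emb_neq // xpair_eqE eq_sym (negbTE ne).
- by rewrite emb_neq // xpair_eqE (negbTE (succ_neq _ vin)).
- by rewrite emb_neq // xpair_eqE (negbTE (succ_neq _ vin)).
- move=> w /adj_either; rewrite !nbrs_out // => /orP[] /orP[] ->; by rewrite ?orbT.
Qed.

(** The same count as in [out_xor], made at the shared entry, whose forced edge leads to its own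
    exit. *)
Lemma in_xor v u : inner r v -> inner r u -> v != u -> succ r x v = succ r y u ->
  F v = ~~ tadj T (emb (u, true)) (emb (succ r y u, false)).
Proof.
move=> vin uin ne e; have [vt ut] := (inner_tour vin, inner_tour uin).
have xt := succ_in_tour x vin.
rewrite ![tadj T (emb (_, true)) _]tadj_sym -e.
apply: (@deg2_xor _ _ _ _ _ (emb (succ r x v, true))).
- exact: emb_deg.
- exact: forced.
- by rewrite emb_neq // xpair_eqE (negbTE ne).
- by rewrite emb_neq // xpair_eqE eq_sym (negbTE (succ_neq _ vin)).
- by rewrite emb_neq // xpair_eqE e eq_sym (negbTE (succ_neq _ uin)).
- move=> w /adj_either; rewrite nbrs_in // e nbrs_in // => /orP[] /orP[] ->; by rewrite ?orbT.
Qed.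

Lemma F_fixed v : inner r v -> succ r x v = succ r y v -> F v.
Proof.
move=> vin e; apply: common_adj; first by rewrite nbrs_out // eqxx orbT.
by rewrite e nbrs_out // eqxx orbT.
Qed.

Lemma F_in_ham v u : inner r v -> inner r u -> v != u -> succ r x v = succ r y u -> F v = F u.
Proof.
move=> vin uin ne e; rewrite (in_xor vin uin ne e) out_xor ?negbK //.
(* Injectivity of the [x]-successor shows that the two successors of [u] differ, as [out_xor]
   requires. *)
by rewrite -e; apply: contra ne => /eqP /succ_inj ->.
Qed.

(** If the exit of [w] chose its [y]-successor [v], the forced edges of [v] and [w] and the two
    chosen edges would form a 4-cycle in [T]. *)
Lemma F_2cycle_ham v w : inner r v -> inner r w ->
  succ r x v = w -> succ r y w = v -> F v -> F w.
Proof.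
move=> vin win vw wv Fv; case Fw: (F w) => //; exfalso.
have [vt wt] := (inner_tour vin, inner_tour win).
have ne : v != w by rewrite -vw eq_sym succ_neq.
have xy : succ r x w != succ r y w by apply: contraFneq Fw => /(F_fixed win).
have back := out_xor win xy; rewrite Fw wv in back.
case: sT => _ acT.
apply: (no_4cycle acT _ _ (forced vt) _ (forced wt) back).
- by rewrite emb_neq // xpair_eqE (negbTE ne).
- by rewrite emb_neq // xpair_eqE (negbTE ne).
- by move: Fv; rewrite vw.
Qed.

(** Only the edges leaving exits of inner nodes depend on the bits; all other edges of the path are
    common to the paths of [x] and [y], hence in [T]. *)
Lemma sub_of_next z :
  (forall v, inner r v -> tadj T (emb (v, true)) (emb (succ r z v, false))) -> H z \subset T.
Proof.
move=> nxt; apply: (hpath_sub (ham_uniq z) (@ham_cover z) (u := u2));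
  first by rewrite /= last_rcons.
have rest_next a : a \in emb (NS r, true) :: rest -> exists b l s,
    ham z = l ++ [:: a, b & s] /\ tadj T a b.
  move=> ar; have [b [l [s E]]] : exists b l s,
      emb (NS r, true) :: rcons rest u2 = l ++ [:: a, b & s].
    rewrite -rcons_cons; case/splitPr: ar => l q.
    have [b [s e]] : exists b s, rcons q u2 = b :: s.
      by case: q => [|b q]; [exists u2, [::]|exists b, (rcons q u2)].
    by exists b, l, s; rewrite rcons_cat rcons_cons e.
  have hE w : exists l', ham w = l' ++ [:: a, b & s].
    by have [l' E'] := ham_rest w; exists (l' ++ l); rewrite E' E catA.
  have [l' E'] := hE z; exists b, l', s; split=> //; apply: common_adj.
    by have [lx Ex] := hE x; apply: adj_infix Ex.
  by have [ly Ey] := hE y; apply: adj_infix Ey.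
move=> a a2; have := ham_cover z a; rewrite inE mem_rcons inE (negbTE a2) mem_cat orFb.
case/or3P=> [/eqP ->|/mapP[[v h]]|ar]; last by apply: rest_next; rewrite inE ar orbT.
- exists (emb (NS 0, false)), [::]; eexists; split; first by [].
  by apply: common_adj; apply: (@adj_infix _ _ _ [::]).
rewrite mem_dbl mem_tour => vt ->; change (is_true (in_tour r v)) in vt; case: h.
  case/orP: (vt) => [vin|/eqP ->]; last by apply: rest_next; rewrite inE eqxx.
  exists (emb (succ r z v, false)); have [l [s E]] := ham_next z vin.
  by rewrite -cat_rcons in E; eexists _, _; split; [exact: E|exact: nxt].
have [l [s E]] := ham_edge z vt.
by exists (emb (v, true)), l, s; split => //; exact: forced.
Qed.

Lemma between i : i < r -> x i != y i -> T = H x \/ T = H y.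
Proof.
move=> ir xy; have [conT acT] := sT.
have mv := F_moved F_in_ham F_2cycle_ham ir xy.
(* By [mv] all moved nodes choose like [NS i], so [T] contains one of the two paths entirely and
   equals it. *)
case c: (F (NS i)); [left|right].
  apply: tree_sub_eq acT _; first by case: (ham_tree x).
  apply: sub_of_next => v vin; case: (eqVneq (succ r x v) (succ r y v)) => [e|ne]; first exact: F_fixed.
  by rewrite mv.
apply: tree_sub_eq acT _; first by case: (ham_tree y).
apply: sub_of_next => v vin; case: (eqVneq (succ r x v) (succ r y v)) => [e|ne].
  by rewrite -e; exact: F_fixed.
by rewrite out_xor // mv // c.
Qed.
End Between.

Lemma ham_inj x y i : i < r -> x i != y i -> H x != H y.
Proof.
move=> ir xy; apply/eqP => E.
have nin : inner r (NS i) by [].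
(* As [i < r], [r] is positive and the two ends [NB i 0] and [NB i r] are distinct. *)
have ne : succ r y (NS i) != succ r x (NS i).
  by rewrite nodeE eqxx /=; case: (x i) (y i) xy => -[] //= _; rewrite ?eqn0Ngt ?[0 == _]eq_sym -lt0n; lia.
have := @nbrs_out x (NS i) (emb (succ r y (NS i), false)) nin.
rewrite (negbTE (emb_neq _ _ _)) ?succ_in_tour ?inner_tour ?xpair_eqE ?(negbTE (succ_neq _ _)) //.
rewrite (negbTE (emb_neq _ _ _)) ?succ_in_tour ?xpair_eqE ?(negbTE ne) //.
by rewrite E nbrs_out // eqxx orbT.
Qed.
End Ham.

Local Open Scope ring_scope.

(** * Adjacency in the 1-skeleton *)

Lemma in_conv_pt (R : realType) (E : finType) (S : {ffun E -> R} -> Prop) p :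
  S p -> in_conv S p.
Proof.
move=> Sp; exists 1%N, (fun=> p), (fun=> 1); split=> //; first by rewrite big_ord1.
by move=> e; rewrite big_ord1 mul1r.
Qed.

Lemma dotp_conv (R : realType) (E : finType) (c z : {ffun E -> R}) k
    (p : 'I_k -> {ffun E -> R}) (w : 'I_k -> R) :
  (forall e, z e = \sum_i w i * p i e) -> dotp c z = \sum_i w i * dotp c (p i).
Proof.
move=> zE; rewrite /dotp; under eq_bigr => e _ do rewrite zE mulr_sumr.
rewrite exchange_big; apply: eq_bigr => i _; rewrite mulr_sumr.
by apply: eq_bigr => e _; rewrite mulrCA.
Qed.

(** In a convex combination that attains the maximum, the weighted gaps to [M] are nonnegative and
    sum to 0, so only [p] and [q] carry weight. The points [p] and [q] may coincide. *)
Lemma face_segment (R : realType) (E : finType) (S : {ffun E -> R} -> Prop)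
    (c p q : {ffun E -> R}) (M : R) :
  S p -> S q -> dotp c p = M -> dotp c q = M ->
  (forall s, S s -> dotp c s <= M) ->
  (forall s, S s -> dotp c s = M -> s = p \/ s = q) ->
  [/\ face_of S c p, face_of S c q & forall z, face_of S c z ->
    exists t : R, [/\ 0 <= t, t <= 1 & forall e, z e = t * p e + (1 - t) * q e]].
Proof.
move=> Sp Sq cp cq leM eqM.
have convM y : in_conv S y -> dotp c y <= M.
  case=> k [pt [w [Spt w0 w1 yE]]]; rewrite (dotp_conv c yE) -[leRHS]mul1r -w1 mulr_suml.
  by apply: ler_sum => i _; rewrite ler_wpM2l // leM.
split; [by split; [exact: in_conv_pt|rewrite cp]|by split; [exact: in_conv_pt|rewrite cq]|].
move=> z [[k [pt [w [Spt w0 w1 zE]]]] zmax].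
have zM : \sum_i w i * (M - dotp c (pt i)) = 0.
  apply/eqP; rewrite eq_le; apply/andP; split; last first.
    by apply: sumr_ge0 => i _; rewrite mulr_ge0 // subr_ge0 leM.
  under eq_bigr => i _ do rewrite mulrBr.
  rewrite sumrB -mulr_suml w1 mul1r -(dotp_conv c zE) subr_le0 -cp.
  exact/zmax/in_conv_pt.
have pq i : w i != 0 -> pt i = p \/ pt i = q.
  move=> wi; apply: eqM => //.
  have /eqP : w i * (M - dotp c (pt i)) = 0.
    by apply: (psumr_eq0P _ zM) => // j _; rewrite mulr_ge0 // subr_ge0 leM.
  by rewrite mulf_eq0 (negbTE wi) subr_eq0 /= => /eqP.
have sw : 1 = \sum_(i | pt i == p) w i + \sum_(i | pt i != p) w i.
  by rewrite -w1 (bigID (fun i => pt i == p)).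
have ge0 (P : pred 'I_k) : 0 <= \sum_(i | P i) w i by apply: sumr_ge0.
exists (\sum_(i | pt i == p) w i); split=> //; first by rewrite [leRHS]sw lerDl.
move=> e; rewrite zE (bigID (fun i => pt i == p)) /=; congr (_ + _).
  by rewrite mulr_suml; apply: eq_bigr => i /eqP ->.
rewrite {1}sw addrC addKr mulr_suml; apply: eq_bigr => i ip.
have [->|/pq[/eqP|-> //]] := eqVneq (w i) 0; first by rewrite !mul0r.
by rewrite (negbTE ip).
Qed.

(* Maximising this functional forces the common edges and forbids the edges outside the union. *)
Definition sepfun (R : realType) n (H1 H2 : {set Kedge n}) : {ffun Kedge n -> R} :=
  [ffun e => (e \in H1 :&: H2)%:R - (e \notin H1 :|: H2)%:R].

Lemma dotp_sepfun (R : realType) n (H1 H2 T : {set Kedge n}) :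
  dotp (sepfun R H1 H2) (charvec R T) =
  #|T :&: (H1 :&: H2)|%:R - #|T :\: (H1 :|: H2)|%:R.
Proof.
rewrite /dotp -!sum1_card !natr_sum !(big_mkcond (fun e => e \in _)) /= -sumrB.
apply: eq_bigr => e _; rewrite !ffunE !inE.
by case: (e \in T); case: (e \in H1); case: (e \in H2); rewrite /= ?mulr1 ?mulr0 ?subrr ?subr0.
Qed.

Lemma sepfun_le (R : realType) n (H1 H2 T : {set Kedge n}) :
  dotp (sepfun R H1 H2) (charvec R T) <= #|H1 :&: H2|%:R.
Proof.
rewrite dotp_sepfun lerBlDr -natrD ler_nat.
exact/(leq_trans (subset_leq_card (subsetIr _ _)))/leq_addr.
Qed.

Lemma sepfun_eq (R : realType) n (H1 H2 T : {set Kedge n}) :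
  dotp (sepfun R H1 H2) (charvec R T) = #|H1 :&: H2|%:R ->
  H1 :&: H2 \subset T /\ T \subset H1 :|: H2.
Proof.
rewrite dotp_sepfun => /eqP; rewrite subr_eq -natrD eqr_nat => /eqP h.
have le := subset_leq_card (subsetIr T (H1 :&: H2)).
have T0 : #|T :\: (H1 :|: H2)| = 0%N.
  by apply/eqP; rewrite -leqn0 -(leq_add2l #|H1 :&: H2|) -h addn0.
split; last by rewrite -setD_eq0 -cards_eq0 T0.
rewrite T0 addn0 in h; apply/setIidPr/eqP.
by rewrite eqEcard subsetIr h leqnn.
Qed.

Lemma sepfun_max (R : realType) n (H1 H2 T : {set Kedge n}) :
  H1 :&: H2 \subset T -> T \subset H1 :|: H2 ->
  dotp (sepfun R H1 H2) (charvec R T) = #|H1 :&: H2|%:R.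
Proof.
move=> le1 le2; rewrite dotp_sepfun (setIidPr le1).
by move: le2; rewrite -setD_eq0 => /eqP ->; rewrite cards0 subr0.
Qed.

(** By [sepfun_eq] only trees between [H1] and [H2] maximise [sepfun], and by assumption these are
    [H1] and [H2] themselves. *)
Lemma svmst_face (R : realType) n (U : {set 'I_n}) (H1 H2 : {set Kedge n}) :
  spanning_tree H1 -> leaves_in H1 U -> spanning_tree H2 -> leaves_in H2 U ->
  (forall T, spanning_tree T -> leaves_in T U ->
     H1 :&: H2 \subset T -> T \subset H1 :|: H2 -> T = H1 \/ T = H2) ->
  exists c : {ffun Kedge n -> R}, let S := @svmst_pts R n U in
  [/\ face_of S c (charvec R H1), face_of S c (charvec R H2) & forall z, face_of S c z ->
    exists t : R, [/\ 0 <= t, t <= 1 &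
      forall e, z e = t * charvec R H1 e + (1 - t) * charvec R H2 e]].
Proof.
move=> s1 l1 s2 l2 only; exists (sepfun R H1 H2); apply: face_segment.
- by exists H1.
- by exists H2.
- by apply: sepfun_max; rewrite ?subsetIl ?subsetUl.
- by apply: sepfun_max; rewrite ?subsetIr ?subsetUr.
- by move=> _ [T [_ _ ->]]; exact: sepfun_le.
- move=> _ [T [sT lT ->]] /sepfun_eq[le1 le2].
  by case: (only T sT lT le1 le2) => ->; [left|right].
Qed.

(** For [H1 = H2] the segment of [svmst_face] shrinks to a point. *)
Lemma svmst_vertex (R : realType) n (U : {set 'I_n}) (H : {set Kedge n}) :
  spanning_tree H -> leaves_in H U -> is_vertex (@svmst_pts R n U) (charvec R H).
Proof.
move=> sH lH; have [|c [fH _ only]] := @svmst_face R n U H H sH lH sH lH.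
  by move=> T _ _; rewrite setIid setUid => a b; left; apply/eqP; rewrite eqEsubset a b.
exists c; split=> // z /only[t [_ _ zE]]; apply/ffunP => e.
by rewrite zE -mulrDl addrC subrK mul1r.
Qed.

Lemma charvec_inj (R : realType) n : injective (@charvec R n).
Proof.
move=> A B /ffunP AB; apply/setP => e; have := AB e; rewrite !ffunE.
by case: (e \in A); case: (e \in B) => // /eqP; rewrite ?oner_eq0 // eq_sym oner_eq0.
Qed.

(** * Size of the gadget and the bound *)

Lemma node_embedding n (U : {set 'I_n}) (u : 'I_n) r :
  (2 * (4 * r ^ 2 + 2 * r + 1) <= n - #|U|)%N ->
  exists emb : node * bool -> 'I_n,
    {in [pred w | in_tour r w.1] &, injective emb} /\
    (forall w, in_tour r w.1 -> emb w \notin U).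
Proof.
move=> le; pose t := tour r xpred0; pose W := enum (~: U).
have sW : size W = (n - #|U|)%N by rewrite -cardE cardsCs setCK card_ord.
have lt (w : node * bool) : in_tour r w.1 -> (2 * index w.1 t + w.2 < size W)%N.
  move=> wt; have it : (index w.1 t < size t)%N by rewrite index_mem mem_tour.
  have := size_tour r xpred0; rewrite sW -/t.
  move: le it; move: (size t) (index w.1 t) (4 * r ^ 2 + 2 * r + 1)%N => a b c.
  by case: w.2 => /=; lia.
(* A node is numbered by its position in one fixed traversal; its entry and exit take two
   consecutive vertices outside [U]. By [lt] the default [u] is never returned for a node of the
   traversal. *)
exists (fun w : node * bool => nth u W (2 * index w.1 t + w.2)); split.
  move=> [v h] [w g] vt wt /eqP; rewrite nth_uniq ?enum_uniq ?lt // => /eqP.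
  rewrite -[(v, h).1]/v -[(w, g).1]/w -[(v, h).2]/h -[(w, g).2]/g => e.
  have ei : index v t = index w t by case: (h) (g) e => -[]; rewrite ?addn0 ?addn1; lia.
  have eh : h = g by rewrite ei in e; case: (h) (g) e => -[] //; rewrite ?addn0 ?addn1; lia.
  rewrite eh; congr pair.
  have vin : v \in t by rewrite mem_tour.
  by rewrite -(nth_index v vin) ei nth_index // mem_tour.
by move=> w /lt lw; have := mem_nth u lw; rewrite mem_enum inE.
Qed.

Lemma ham_clique (R : realType) n (U : {set 'I_n}) (u1 u2 : 'I_n) r :
  u1 \in U -> u2 \in U -> u1 != u2 ->
  (2 * (4 * r ^ 2 + 2 * r + 1) <= n - #|U|)%N ->
  exists v : 'I_(2 ^ r) -> {ffun Kedge n -> R}, skel_clique (@svmst_pts R n U) v.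
Proof.
move=> U1 U2 u12 /(@node_embedding n U u1)[emb [emb_inj embU]].
have card : (2 ^ r)%N = #|{: r.-tuple bool}| by rewrite card_tuple card_bool.
pose bits (i : 'I_(2 ^ r)) : nat -> bool := nth false (enum_val (cast_ord card i)).
pose H i := hpath (ham u1 u2 r emb (bits i)).
have sH i : spanning_tree (H i) by exact: ham_tree U1 U2 u12 emb_inj embU (bits i).
have lH i : leaves_in (H i) U by exact: ham_leaves U1 U2 u12 emb_inj embU (bits i).
have vH i : is_vertex (@svmst_pts R n U) (charvec R (H i)) by apply: svmst_vertex.
exists (fun i => charvec R (H i)); split=> // i j ij.
have [k kr diff] : exists2 k, (k < r)%N & bits i k != bits j k.
  have : [exists k : 'I_r, bits i k != bits j k].
    rewrite -negb_forall; apply: contra ij => /forallP same.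
    rewrite -(inj_eq (@cast_ord_inj _ _ card)) -(inj_eq enum_val_inj); apply/eqP.
    by apply: eq_from_tnth => k; rewrite !(tnth_nth false); exact/eqP/same.
  by case/existsP=> k diff; exists k.
have ne : H i != H j := ham_inj U1 U2 u12 emb_inj embU kr diff.
split=> //; first by move/charvec_inj => e; rewrite e eqxx in ne.
apply: svmst_face => // T sT lT capT Tcup.
exact: (between (x := bits i) (y := bits j) U1 U2 u12 emb_inj embU sT lT capT Tcup kr diff).
Qed.

(** This serves the case [r = 0]: possibly a single vertex lies outside [U], while even the gadget
    without rows has the node [NS 0] and needs two. *)
Lemma trivial_clique (R : realType) n (U : {set 'I_n}) (u1 u2 : 'I_n) :
  u1 \in U -> u2 \in U -> u1 != u2 ->
  exists v : 'I_1 -> {ffun Kedge n -> R}, skel_clique (@svmst_pts R n U) v.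
Proof.
move=> U1 U2 u12; pose s := u1 :: rcons [seq v <- enum 'I_n | v \notin [:: u1; u2]] u2.
have us : uniq s.
  rewrite /s cons_uniq mem_rcons inE (negbTE u12) mem_filter !inE eqxx rcons_uniq.
  by rewrite mem_filter !inE eqxx orbT filter_uniq ?enum_uniq.
have cov v : v \in s.
  by rewrite !(inE, mem_rcons) mem_filter mem_enum !inE; case: (v == u1); case: (v == u2).
exists (fun=> charvec R (hpath s)); split; last by move=> i j; rewrite !ord1 eqxx.
by move=> _; apply: svmst_vertex; [exact: hpath_tree|exact: hpath_leaves].
Qed.

Lemma clique_bound (R : realType) (k r : nat) : (k <= (2 * r + 9) ^ 2)%N ->
  @powR R 2 ((Num.sqrt k%:R - 9) / 2) <= (2 ^ r)%:R.
Proof.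
move=> kr; rewrite natrX -powR_mulrn //; apply: ler_powR; first by rewrite ler1n.
have : Num.sqrt (k%:R : R) <= (2 * r + 9)%:R.
  by rewrite -[leRHS]ger0_norm // -sqrtr_sqr ler_wsqrtr // -natrX ler_nat.
rewrite natrD natrM; lra.
Qed.

(* omega(SVMST_{n,U}) >= bound  <=>  the 1-skeleton has a clique of some size m >= bound *)
Theorem theorem7 (R : realType) (n : nat) (U : {set 'I_n}) :
  (2 <= #|U|)%N -> (#|U| <= n.-1)%N ->
  exists (m : nat) (v : 'I_m -> {ffun Kedge n -> R}),
    skel_clique (@svmst_pts R n U) v /\
    @powR R 2 ((Num.sqrt (((n - #|U| - 1)./2)%:R) - 9) / 2) <= m%:R.
Proof.
move=> /card_gt1P[u1 [u2 [U1 U2 u12]]] _; set k := (_./2).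
(* A large [r] is wanted for [clique_bound] and a small one for the gadget to fit outside [U]; hence
   the least admissible [r]. *)
have [r kr rmin] : exists2 r, (k <= (2 * r + 9) ^ 2)%N &
    forall q, (k <= (2 * q + 9) ^ 2)%N -> (r <= q)%N.
  have ex : exists r, (k <= (2 * r + 9) ^ 2)%N by exists k; nia.
  by case: (ex_minnP ex) => r kr rmin; exists r.
suff [v clv] : exists v : 'I_(2 ^ r) -> {ffun Kedge n -> R}, skel_clique (@svmst_pts R n U) v.
  by exists (2 ^ r)%N, v; split=> //; exact: clique_bound.
case: r kr rmin => [_ _|r _ rmin]; first exact: trivial_clique U1 U2 u12.
apply: ham_clique U1 U2 u12 _.
(* By minimality k exceeds (2r+9)^2 >= 4(r+1)^2 + 2(r+1) + 1, an upper bound for the number of nodes;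
   each node takes two of the at least 2k vertices outside U. *)
have big : ((2 * r + 9) ^ 2 < k)%N.
  by rewrite ltnNge; apply/negP => /rmin; rewrite ltnn.
have : (2 * k <= n - #|U| - 1)%N by rewrite /k mul2n -{2}(odd_double_half (_ - 1)) leq_addl.
by move=> le; apply: (leq_trans _ (leq_trans le (leq_subr _ _))); rewrite leq_pmul2l //; nia.
Qed.
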